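(* For all $\eta>0$, as $T\to+\infty$, $$\mathbb{P}_T\left(|\mathrm{Tr}(\gamma)|>2 \text{ and } |\epsilon_\gamma|=\epsilon_{\mathbf K}\right)=1-O_\eta\left(T^{-\frac12+\eta}\right).$$ In particular, the ring $\mathcal{O}_{\mathbf K}$ is unlikely to have a unit of negative norm, i.e. the $\mathbb{P}_T$-probability that $\gamma$ is hyperbolic and $\mathcal{O}_{\mathbf K}$ has a unit of norm $-1$ tends to $0$ as $T\to+\infty$.
   Context: $\Gamma=\mathbf{SL}(2,\mathbf Z)$, $\|\gamma\|=\sqrt{\mathrm{Tr}({}^t\gamma\gamma)}$ is the Frobenius norm, $\Gamma_T=\{\gamma\in\Gamma: \|\gamma\|\le T\}$, and $\mathbb{P}_T$ is the uniform probability measure on the finite set $\Gamma_T$. A matrix $\gamma\in\Gamma$ is hyperbolic if $|\mathrm{Tr}(\gamma)|>2$. For hyperbolic $\gamma$, $\mathbf K=\mathbf Q(\sqrt{\mathrm{Tr}(\gamma)^2-4})\subset\mathbf R$ is a real quadratic field depending on $\gamma$, with ring of integers $\mathcal{O}_{\mathbf K}$ and fundamental unit $\epsilon_{\mathbf K}>1$ (the smallest unit of $\mathcal{O}_{\mathbf K}$ greater than $1$). The eigenvalues of $\gamma$ are $\epsilon_\gamma,\epsilon_\gamma^{-1}$, labelled so that $|\epsilon_\gamma|>1$; they are units of $\mathcal{O}_{\mathbf K}$. *)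

(* Defs.v *)
From HB Require Import structures.
From mathcomp Require Import all_boot all_order all_algebra.
From mathcomp Require Import finmap.
From mathcomp Require Import all_classical all_reals all_analysis.

Set Implicit Arguments.
Unset Strict Implicit.
Unset Printing Implicit Defensive.

Import Order.TTheory GRing.Theory Num.Theory.
Import numFieldNormedType.Exports.

Local Open Scope classical_set_scope.
Local Open Scope ring_scope.

Definition SL2Z : set 'M[int]_2 := [set g | \det g = 1].

Definition frobenius_norm (R : realType) (g : 'M[int]_2) : R :=
  Num.sqrt (\tr (g^T *m g))%:~R.

Definition SL2Z_ball (R : realType) (T : R) : set 'M[int]_2 :=
  SL2Z `&` [set g | frobenius_norm R g <= T].

Lemma finite_SL2Z_ball (R : realType) (T : R) : finite_set (SL2Z_ball T).
Proof.
pose N := Num.bound (T ^+ 2).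
pose f (M : 'M['I_(N + N).+1]_2) : 'M[int]_2 :=
  \matrix_(i, j) ((M i j)%:Z - N%:Z).
apply: (@sub_finite_set _ _ (f @` setT)); last first.
  by apply: finite_image; exact: finite_finset.
move=> g [_ /= gT].
have T0 : 0 <= T by apply: le_trans gT; exact: sqrtr_ge0.
have trE : \tr (g^T *m g) = \sum_i \sum_j g j i ^+ 2.
  rewrite /mxtrace; apply: eq_bigr => i _; rewrite mxE.
  by apply: eq_bigr => j _; rewrite mxE expr2.
have tr0 : 0 <= \tr (g^T *m g).
  by rewrite trE; apply: sumr_ge0 => i _; apply: sumr_ge0 => j _; exact: sqr_ge0.
have trN : \tr (g^T *m g) <= N%:Z.
  rewrite -(ler_int R); apply: (@le_trans _ _ (T ^+ 2)).
    by rewrite -(@sqr_sqrtr _ _%:~R) ?ler0z// lerXn2r// nnegrE// sqrtr_ge0.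
  by apply: ltW; rewrite /N; apply: archi_boundP; exact: sqr_ge0.
have entN i j : `|g i j| <= N%:Z.
  apply: le_trans trN; rewrite trE (bigD1 j)//= (bigD1 i)//=.
  apply: (@le_trans _ _ (g i j ^+ 2)).
    rewrite -real_normK ?num_real// -abszE.
    by rewrite expr2 -PoszM lez_nat; case: (absz (g i j)) => // n; rewrite leq_pmulr.
  rewrite -addrA lerDl addr_ge0//; apply: sumr_ge0 => k _; first exact: sqr_ge0.
  by apply: sumr_ge0 => l _; exact: sqr_ge0.
exists (\matrix_(i, j) inord (absz (g i j + N%:Z))) => //.
apply/matrixP => i j; rewrite !mxE inordK; last first.
  have := entN i j; rewrite ler_norml => /andP[h1 h2].
  by rewrite ltnS -lez_nat gez0_abs ?PoszD ?lerD2r// -lerBlDr sub0r.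
have := entN i j; rewrite ler_norml => /andP[h1 _].
by rewrite gez0_abs ?addrK// -lerBlDr sub0r.
Qed.

Definition prob (R : realType) (T : R) (E : set 'M[int]_2) : R :=
  #|` fset_set (SL2Z_ball T `&` E)|%:R / #|` fset_set (SL2Z_ball T)|%:R.

Definition hyperbolic (g : 'M[int]_2) : Prop := 2 < `|\tr g|.

(* Q(x): every subfield contains Q, so no explicit mention of Q is needed;
   [S : {pred R}] with [divring_closed S] is exactly a subfield of R. *)
Definition adjoin_rat (R : realType) (x : R) : set R :=
  [set y | forall S : {pred R}, divring_closed S -> x \in S -> y \in S].

(* Only meaningful when [g] is hyperbolic: [Num.sqrt] is 0 on negatives. *)
Definition trace_field (R : realType) (g : 'M[int]_2) : set R :=
  adjoin_rat (Num.sqrt ((\tr g) ^+ 2 - 4)%:~R).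
Arguments trace_field : clear implicits.

Definition ring_of_integers (R : realType) (K : set R) : set R :=
  K `&` [set x | integralOver (intr : int -> R) x].

Definition unit_of (R : realType) (A : set R) : set R :=
  [set u | [/\ A u, u != 0 & A u^-1]].

Definition is_fundamental_unit (R : realType) (K : set R) (u : R) : Prop :=
  let U := [set v | unit_of (ring_of_integers K) v /\ 1 < v] in
  U u /\ forall v, U v -> u <= v.

(* The default 0 is returned only if no fundamental unit exists. *)
Definition fundamental_unit (R : realType) (K : set R) : R :=
  xget 0 [set u | is_fundamental_unit K u].

Lemma fundamental_unitE (R : realType) (K : set R) (u : R) :
  is_fundamental_unit K u -> fundamental_unit K = u.
Proof.
move=> Ku; apply: xget_unique => // v Kv; apply/eqP.
by rewrite eq_le Ku.2 ?Kv.2//; [exact: Ku.1|exact: Kv.1].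
Qed.

(* The eigenvalue of modulus > 1; it exists and is unique for hyperbolic [g] in
   SL(2,Z), and the default 0 is returned if there is none. *)
Definition eps_eigenvalue (R : realType) (g : 'M[int]_2) : R :=
  xget 0 [set e : R | eigenvalue (map_mx intr g) e /\ 1 < `|e|].

(* [b] is a Q-basis of the Q-subspace K of R *)
Definition rat_basis (R : realType) (K : set R) (n : nat) (b : 'I_n -> R) :
    Prop :=
  set_bij [set: 'rV[rat]_n] K (fun c => \sum_(i < n) ratr (c 0 i) * b i).

(* N_{K/Q}(x) = c, as the determinant of multiplication by [x] on K, written
   in some Q-basis of K *)
Definition has_field_norm (R : realType) (K : set R) (x : R) (c : rat) : Prop :=
  exists (n : nat) (b : 'I_n -> R) (M : 'M[rat]_n),
    [/\ rat_basis K b,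
        forall i, x * b i = \sum_(j < n) ratr (M i j) * b j
      & c = \det M].

(* Main.v *)
(* The modulus [eps] of the large eigenvalue of a hyperbolic [g] is a unit > 1
   of its quadratic field, of norm 1 and with [eps + 1/eps = |tr g|], so
   [eps = e ^ n] for the fundamental unit [e].  If [n >= 2], then
   [e <= sqrt (2T)] and [n = O(log T)]; as [e] is a root of [X^2 - sX +- 1] with
   [s] an integer, at most [O(T^(1/2 + eta))] traces arise this way.  A given
   trace is taken by [O(T^(1 + eta))] matrices of norm at most [T]: the entry [a]
   determines [d], and [b, c] then factor [ad - 1], so the divisor bound applies.
   On the other hand completing coprime pairs [(a, c)] to matrices of
   determinant 1 shows that the ball contains at least [T^2 / 64] matrices.
   Finally, if [n = 1] then every unit is up to sign a power of [eps], hence has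
   norm 1, so fields with a unit of norm -1 only arise from the exceptional set. *)

Require Import Defs.
From HB Require Import structures.
From mathcomp Require Import all_boot all_order all_algebra.
From mathcomp Require Import finmap zify ring lra.
From mathcomp Require Import all_classical all_reals all_analysis.

Import Order.TTheory GRing.Theory Num.Theory.
Import numFieldNormedType.Exports.

Local Open Scope classical_set_scope.
Local Open Scope ring_scope.

(** * Quadratic integers *)

(** Gauss's lemma. With [p = a q] and [P = q r] for integer polynomials [q], [r], comparing leading
    coefficients shows that [a] is the leading coefficient of [r], hence an integer. *)
Lemma monic_dvdp_int (p : {poly rat}) (P : {poly int}) :
  p \is monic -> P \is monic -> p %| map_poly (intr : int -> rat) P ->
  forall i, exists z : int, p`_i = z%:~R.
Proof.
move=> mp mP /dvdpP_rat_int[q [a a0 pE] [r PE]] i.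
have := congr1 (fun s => lead_coef (a *: map_poly (intr : int -> rat) s)) PE.
rewrite rmorphM scalerAl -pE lead_coefZ lead_coefM /=.
have /monicP -> : map_poly (intr : int -> rat) P \is monic by exact: monic_map.
rewrite (monicP mp) mul1r mulr1 lead_coef_map_inj//; last exact: intr_inj.
move=> aE; exists (lead_coef r * q`_i).
by rewrite pE coefZ coef_map/= aE intrM.
Qed.

Section Integrality.
Context {R : realType}.
Implicit Types u v x : R.

Definition irrational x := forall r : rat, x <> ratr r.

Lemma root_int_ratr (P : {poly int}) x :
  root (map_poly (intr : int -> R) P) x ->
  root (map_poly (ratr : rat -> R) (map_poly (intr : int -> rat) P)) x.
Proof.
rewrite -map_poly_comp; congr (root _ x).
by apply: eq_map_poly => z /=; rewrite ratr_int.
Qed.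

Lemma integral_ratr (r : rat) :
  integralOver (intr : int -> R) (ratr r) -> exists z : int, r = z%:~R.
Proof.
case=> P mP /root_int_ratr.
rewrite (fmorph_root (ratr : rat -> R)) root_factor_theorem => dv.
have [z rz] := monic_dvdp_int _ _ (monicXsubC r) mP dv 0.
by exists (- z); move: rz; rewrite coefB coefX coefC/= sub0r => rE; rewrite intrN -rE opprK.
Qed.

(** Irrationality makes [X^2 - aX - b] the minimal polynomial of [x], so it divides any monic
    integer polynomial vanishing at [x], and Gauss's lemma applies. *)
Lemma integral_quadratic x (a b : rat) : irrational x ->
  integralOver (intr : int -> R) x -> x ^+ 2 = ratr a * x + ratr b ->
  (exists z : int, a = z%:~R) /\ (exists z : int, b = z%:~R).
Proof.
move=> irr [P mP /root_int_ratr rP] xE.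
pose p : {poly rat} := 'X^2 - (a *: 'X + b%:P).
have sab : (size (a *: 'X + b%:P)%R < size ('X^2 : {poly rat}))%N.
  rewrite size_polyXn (leq_ltn_trans (size_polyD _ _))// gtn_max.
  by rewrite (leq_ltn_trans (size_scale_leq _ _)) ?size_polyX// (leq_ltn_trans (size_polyC_leq1 _)).
have mp : p \is monic by rewrite monicE lead_coefDl ?size_polyN ?sab// lead_coefXn.
have sp : size p = 3%N by rewrite size_polyDl ?size_polyN ?sab// size_polyXn.
have px : root (map_poly ratr p) x.
  by rewrite rootE /p !(rmorphB, rmorphD)/= map_polyXn map_polyZ/= map_polyX map_polyC/= !hornerE xE subrr.
(* The remainder has degree at most 1 and vanishes at the irrational [x], so both its coefficients
   are zero. *)
have dv : p %| map_poly (intr : int -> rat) P.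
  rewrite /dvdp; set q := _ %% _.
  have sq : (size q <= 2)%N by rewrite -ltnS -sp ltn_modp -size_poly_gt0 sp.
  have : root (map_poly ratr q) x.
    move: rP; rewrite (divp_eq (map_poly intr P) p) -/q rmorphD rmorphM/=.
    by rewrite rootE hornerD hornerM (eqP px) mulr0 add0r.
  have -> : q = q`_1 *: 'X + (q`_0)%:P.
    apply/polyP => -[|[|i]]; rewrite coefD coefZ coefX coefC/= ?mulr0 ?mulr1 ?add0r ?addr0//.
    by rewrite nth_default// (leq_trans sq).
  rewrite rootE rmorphD/= map_polyZ/= map_polyX map_polyC/= !hornerE.
  have [->|q1] := eqVneq q`_1 0.
    by rewrite rmorph0 mul0r add0r fmorph_eq0 => /eqP ->; rewrite scale0r polyC0 addr0.
  move=> /eqP h; exfalso; apply: (irr (- q`_0 / q`_1)).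
  rewrite rmorphM rmorphN fmorphV/=.
  by apply: (canRL (mulfK _)); rewrite ?fmorph_eq0// mulrC; apply/eqP; rewrite -addr_eq0 h.
have pcoef := monic_dvdp_int _ _ mp mP dv.
split.
  have [z] := pcoef 1%N; rewrite /p !(coefB,coefXn,coefD,coefZ,coefX,coefC)/= ?mulr0n mulr1 addr0 add0r => aE.
  by exists (- z); rewrite intrN -aE opprK.
have [z] := pcoef 0%N; rewrite /p !(coefB,coefXn,coefD,coefZ,coefX,coefC)/= ?mulr0n mulr0 !add0r => aE.
by exists (- z); rewrite intrN -aE opprK.
Qed.

End Integrality.

(** * Units of quadratic fields *)

Section QuadraticField.
Context {R : realType}.
Implicit Types u v x y : R.

(** The numbers [p + q x] already form a subfield containing [x]: inverses come from multiplying by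
    the conjugate [p - q x]. *)
Lemma adjoin_rat_sqrt x (d : rat) y : x ^+ 2 = ratr d ->
  adjoin_rat x y -> exists p q : rat, y = ratr p + ratr q * x.
Proof.
move=> xd; pose S : {pred R} := fun z => `[< exists p q : rat, z = ratr p + ratr q * x >].
move=> /(_ S) yS; suff : y \in S by move/asboolP.
apply: yS; last by apply/asboolP; exists 0, 1; rewrite rmorph0 rmorph1 add0r mul1r.
have ratV (z : R) : z \in S -> z^-1 \in S.
  move=> /asboolP[p [q ->]]; apply/asboolP.
  (* If [x] is itself rational, the conjugate can vanish while the element does not; the element is
     then [2p]. *)
  have [n0|n0] := eqVneq (ratr p - ratr q * x) 0.
    exists (p + p)^-1, 0; rewrite rmorph0 mul0r addr0 fmorphV rmorphD/=.
    by move/eqP: n0; rewrite subr_eq0 => /eqP <-.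
  have [z0|z0] := eqVneq (ratr p + ratr q * x) 0.
    by exists 0, 0; rewrite z0 invr0 rmorph0 mul0r addr0.
  have nE : (ratr p + ratr q * x) * (ratr p - ratr q * x) = ratr (p ^+ 2 - q ^+ 2 * d).
    by rewrite rmorphB/= rmorphXn/= (rmorphM _ (q ^+ 2))/= rmorphXn/= -xd; ring.
  have N0 : (ratr (p ^+ 2 - q ^+ 2 * d) : R) != 0 by rewrite -nE mulf_neq0.
  exists (p / (p ^+ 2 - q ^+ 2 * d)), (- q / (p ^+ 2 - q ^+ 2 * d)).
  rewrite rmorphM rmorphM rmorphN fmorphV/= -nE; field.
  by rewrite z0 n0.
split.
- by apply/asboolP; exists 1, 0; rewrite rmorph1 rmorph0 mul0r addr0.
- move=> u v /asboolP[p [q ->]] /asboolP[p' [q' ->]]; apply/asboolP.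
  by exists (p - p'), (q - q'); rewrite !rmorphB/=; ring.
- move=> u v /asboolP[p [q ->]] /ratV/asboolP[p' [q' ->]]; apply/asboolP.
  exists (p * p' + q * q' * d), (p * q' + q * p').
  by rewrite !(rmorphD, rmorphM)/= -xd; ring.
Qed.

Lemma adjoin_rat1 x : adjoin_rat x 1.
Proof. by move=> S [S1 _ _] _. Qed.

Lemma adjoin_ratB x u v :
  adjoin_rat x u -> adjoin_rat x v -> adjoin_rat x (u - v).
Proof. by move=> Ku Kv S cS xS; case: (cS) => _ SB _; apply: SB; [exact: Ku|exact: Kv]. Qed.

Lemma adjoin_rat_div x u v :
  adjoin_rat x u -> adjoin_rat x v -> adjoin_rat x (u / v).
Proof. by move=> Ku Kv S cS xS; case: (cS) => _ _ Sd; apply: Sd; [exact: Ku|exact: Kv]. Qed.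

Lemma adjoin_ratV x u : adjoin_rat x u -> adjoin_rat x u^-1.
Proof. by move=> Ku; rewrite -[u^-1]mul1r; apply: adjoin_rat_div => //; exact: adjoin_rat1. Qed.

Lemma adjoin_ratM x u v :
  adjoin_rat x u -> adjoin_rat x v -> adjoin_rat x (u * v).
Proof. by move=> Ku Kv; rewrite -[v]invrK; apply: adjoin_rat_div => //; exact: adjoin_ratV. Qed.

Lemma adjoin_ratN x u : adjoin_rat x u -> adjoin_rat x (- u).
Proof.
move=> Ku; rewrite -sub0r -(subrr 1); apply: adjoin_ratB => //.
by apply: adjoin_ratB; exact: adjoin_rat1.
Qed.

Lemma adjoin_ratD x u v :
  adjoin_rat x u -> adjoin_rat x v -> adjoin_rat x (u + v).
Proof. by move=> Ku Kv; rewrite -[v]opprK; apply: adjoin_ratB => //; exact: adjoin_ratN. Qed.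

Lemma adjoin_rat_int x (z : int) : adjoin_rat x z%:~R.
Proof.
have natP n : adjoin_rat x n%:R.
  elim: n => [|n IHn]; first by rewrite mulr0n -(subrr 1); apply: adjoin_ratB; exact: adjoin_rat1.
  by rewrite -natr1; apply: adjoin_ratD => //; exact: adjoin_rat1.
by case: z => n; rewrite ?NegzE ?intrN; [exact: natP|exact: adjoin_ratN (natP _)].
Qed.

Local Notation unitsO x := (unit_of (ring_of_integers (adjoin_rat x))).

Lemma unitsOV x u : unitsO x u -> unitsO x u^-1.
Proof. by case=> Ou u0 OV; split; rewrite ?invr_neq0 ?invrK. Qed.

Lemma unitsOM x u v : unitsO x u -> unitsO x v -> unitsO x (u * v).
Proof.
move=> [[Ku Iu] u0 [KVu IVu]] [[Kv Iv] v0 [KVv IVv]]; split; rewrite ?mulf_neq0// ?invfM.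
  by split; [exact: adjoin_ratM|exact: (@integral_mul _ _ intr)].
by split; [exact: adjoin_ratM|exact: (@integral_mul _ _ intr)].
Qed.

Lemma unitsO1 x : unitsO x 1.
Proof.
have O1 : ring_of_integers (adjoin_rat x) 1.
  by split; [exact: adjoin_rat1|exact: (@integral1 _ _ intr)].
by split; rewrite ?oner_neq0 ?invr1.
Qed.

Lemma unitsON x u : unitsO x u -> unitsO x (- u).
Proof.
have ON v : ring_of_integers (adjoin_rat x) v -> ring_of_integers (adjoin_rat x) (- v).
  by move=> [Kv Iv]; split; [exact: adjoin_ratN|exact: (@integral_opp _ _ intr)].
by case=> Ou u0 OV; split; rewrite ?oppr_eq0 ?invrN//; exact: ON.
Qed.

Lemma unitsO_norm x u : unitsO x u -> unitsO x `|u|.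
Proof.
by move=> Uu; have [_|_] := ger0P u => //; exact: unitsON.
Qed.

(* [s] is the trace of [u] and [e] its norm. *)
Lemma unitsO_quadratic x (d : rat) u : x ^+ 2 = ratr d -> unitsO x u ->
  `|u| = 1 \/
  irrational u /\ exists s e : int, (e = 1 \/ e = -1) /\ u ^+ 2 = s%:~R * u - e%:~R.
Proof.
move=> xd [[Ku Iu] u0 [_ IV]].
have int_unit (a b : int) : a * b = 1 -> `|a| = 1.
  by move=> /(congr1 absz); rewrite abszM => /eqP; rewrite muln_eq1 => /andP[/eqP h _]; lia.
have [[r ur]|irr] := pselect (exists r : rat, u = ratr r).
  left; move: Iu IV; rewrite ur -fmorphV => /integral_ratr[z rz] /integral_ratr[w Vw].
  have r0 : r != 0 by move: u0; rewrite ur fmorph_eq0.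
  have zw : z * w = 1 by apply: (@intr_inj rat); rewrite intrM -rz -Vw divff.
  by rewrite rz ratr_int -intr_norm (int_unit _ _ zw).
right; have {}irr : irrational u by move=> r ur; apply: irr; exists r.
split=> //; have [p [q uE]] := adjoin_rat_sqrt _ _ _ xd Ku.
have uQ : u ^+ 2 = ratr (p + p) * u + ratr (q ^+ 2 * d - p ^+ 2).
  by rewrite uE rmorphB/= !rmorphXn/= (rmorphM _ (q ^+ 2))/= !(rmorphD, rmorphXn)/= -xd; ring.
have [[s sE] [n nE]] := integral_quadratic _ _ _ irr Iu uQ.
have n0 : (n%:~R : R) != 0.
  apply/eqP => n0; apply: (irr s%:~R); move: uQ; rewrite sE nE !ratr_int n0 addr0 expr2.
  by move/(mulIf u0).
(* The inverse is integral too, and the constant term of its quadratic equation is [1/n]; so both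
   [n] and [1/n] are integers. *)
have irrV : irrational u^-1 by move=> r ur; apply: (irr r^-1); rewrite fmorphV /= -ur invrK.
have VQ : u^-1 ^+ 2 = ratr (- s%:~R / n%:~R) * u^-1 + ratr (n%:~R^-1).
  rewrite rmorphM rmorphN !fmorphV/= !ratr_int; move: uQ; rewrite sE nE !ratr_int => uQ.
  have nu : n%:~R = u ^+ 2 - s%:~R * u by rewrite uQ; ring.
  by rewrite nu; field; rewrite -nu n0.
have [_ [m mE]] := integral_quadratic _ _ _ irrV IV VQ.
have nm : n * m = 1 by apply: (@intr_inj rat); rewrite intrM -mE divff// intr_eq0 -(intr_eq0 R).
exists s, (- n); split; first by have := int_unit _ _ nm; lia.
by rewrite uQ sE nE !ratr_int intrN opprK.
Qed.

End QuadraticField.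

(** * Units greater than 1 and the fundamental unit *)

Section FundamentalUnit.
Context {R : realType} {x : R} {d : rat} (xd : x ^+ 2 = ratr d).
Implicit Types u v : R.

Local Notation O := (ring_of_integers (adjoin_rat x)).

(** The trace is positive because [s u = u^2 + e] and [u > 1]. *)
Lemma unit_gt1_quadratic u : unit_of O u -> 1 < u ->
  exists s e : int, [/\ 0 < s, e = 1 \/ e = -1 & u ^+ 2 = s%:~R * u - e%:~R].
Proof.
move=> Uu u1; case: (unitsO_quadratic _ _ _ xd Uu) => [|[_ [s [e [eE uE]]]]].
  by rewrite ger0_norm ?(ltW (lt_trans ltr01 u1))// => u1'; rewrite u1' ltxx in u1.
exists s, e; split=> //; rewrite -(ltr0z R).
by case: eE uE => -> uE; nra.
Qed.

(** A lower bound uniform over all fields, which later makes exponents logarithmic in [T]. In norm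
    -1, [u^2 = s u + 1 > 2]; in norm 1, [s = u + 1/u > 2] forces [s >= 3]. *)
Lemma unit_gt1_sqr u : unit_of O u -> 1 < u -> 2 < u ^+ 2.
Proof.
move=> Uu u1; have [s [e [s0 eE uE]]] := unit_gt1_quadratic _ Uu u1.
have : (1 : R) <= s%:~R by rewrite (ler_int R 1).
case: eE uE => -> uE s1; last by rewrite uE; nra.
have : (2 : R) < s%:~R by rewrite -(ltr_pM2r (lt_trans ltr01 u1)); nra.
by rewrite (ltr_int R 2) -lezD1 -(ler_int R) => ?; rewrite uE; nra.
Qed.

(* The integer [u ^+ 2 + u ^- 2] increases with [u > 1], so it well-orders the
   units greater than 1. *)
Lemma unit_height u : unit_of O u -> 1 < u ->
  exists n : nat, u ^+ 2 + u ^- 2 = n%:R.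
Proof.
move=> Uu u1; have [s [e [s0 eE uE]]] := unit_gt1_quadratic _ Uu u1.
have u0 : u != 0 by case: Uu.
(* The conjugate [s - u] equals [e / u], so this is the trace of [u^2]. Squaring removes the sign:
   in norm -1 it is [u - 1/u], not [u + 1/u], that is an integer. *)
have : u ^+ 2 + u ^- 2 = (s ^+ 2 - 2 * e)%:~R.
  have e2 : (e%:~R : R) ^+ 2 = 1 by case: eE => ->; rewrite ?intrN ?sqrrN expr1n.
  have uV : u^-1 = e%:~R * (s%:~R - u).
    apply: (mulIf u0); rewrite mulVf//.
    have -> : e%:~R * (s%:~R - u) * u = e%:~R * (s%:~R * u - u ^+ 2) by ring.
    by rewrite uE -[LHS]e2; ring.
  rewrite -exprVn uV exprMn e2 intrB rmorphXn intrM/= mul1r sqrrB uE; ring.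
move=> h; exists (absz (s ^+ 2 - 2 * e)%R); rewrite h [RHS]pmulrn gez0_abs//.
by rewrite -(ler0z R) -h addr_ge0 ?invr_ge0 ?sqr_ge0.
Qed.

Lemma height_lt u v : 1 < v -> v < u -> v ^+ 2 + v ^- 2 < u ^+ 2 + u ^- 2.
Proof.
move=> v1 vu; have v2 : 1 < v ^+ 2 by nra.
have uv2 : v ^+ 2 < u ^+ 2 by nra.
rewrite -subr_gt0.
have -> : u ^+ 2 + u ^- 2 - (v ^+ 2 + v ^- 2) =
    (u ^+ 2 - v ^+ 2) * (1 - (u ^+ 2)^-1 * (v ^+ 2)^-1).
  by field; apply/andP; split; apply/eqP; nra.
apply: mulr_gt0; first by rewrite subr_gt0.
rewrite subr_gt0 -invfM invf_lt1; nra.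
Qed.

Lemma exists_fundamental_unit u : unit_of O u -> 1 < u ->
  exists e, is_fundamental_unit (adjoin_rat x) e.
Proof.
move=> Uu u1.
pose P n := `[< exists v, [/\ unit_of O v, 1 < v & v ^+ 2 + v ^- 2 = n%:R] >].
have exP : exists n, P n.
  by have [n un] := unit_height _ Uu u1; exists n; apply/asboolP; exists u.
case: (ex_minnP exP) => n /asboolP[e [Ue e1 en]] nmin.
exists e; split=> // v [Uv v1]; rewrite leNgt; apply/negP => ve.
have [m vm] := unit_height _ Uv v1.
have := height_lt _ _ v1 ve; rewrite en vm ltr_nat ltnNge => /negP; apply.
by apply: nmin; apply/asboolP; exists v.
Qed.

(** Descent on the height: if [u] is not [e], then [u > e], and [u / e] is again a unit greater than
    1, of smaller height. *)
Lemma unit_gt1_power e u : is_fundamental_unit (adjoin_rat x) e ->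
  unit_of O u -> 1 < u -> exists2 n, (0 < n)%N & u = e ^+ n.
Proof.
move=> [[Ue e1] emin] Uu u1; have [m] := unit_height _ Uu u1.
elim/ltn_ind: m u Uu u1 => m IHm u Uu u1 um.
have := emin _ (conj Uu u1); rewrite le_eqVlt => /predU1P[<-|eu].
  by exists 1%N; rewrite ?expr1.
have e0 := lt_trans ltr01 e1.
have ue1 : 1 < u / e by rewrite ltr_pdivlMr ?mul1r.
have Uue : unit_of O (u / e) by apply: unitsOM => //; exact: unitsOV.
have [k uek] := unit_height _ Uue ue1.
have : u / e < u by rewrite ltr_pdivrMr// ltr_pMr// (lt_trans ltr01).
move=> /(height_lt _ _ ue1); rewrite um uek ltr_nat => km.
have [n n0 ueE] := IHm _ km _ Uue ue1 uek.
by exists n.+1; rewrite // exprSr -ueE divfK ?gt_eqF.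
Qed.

End FundamentalUnit.

(** * The field attached to a hyperbolic matrix *)

Lemma det_mx2 (S : comNzRingType) (A : 'M[S]_2) :
  \det A = A 0 0 * A 1 1 - A 0 1 * A 1 0.
Proof.
have l01 : lift ord0 ord0 = 1 :> 'I_2 by exact: val_inj.
have l10 : lift 1 ord0 = 0 :> 'I_2 by exact: val_inj.
rewrite (expand_det_row _ ord0) !big_ord_recl big_ord0 /cofactor !det_mx11 !mxE/=.
by rewrite !l01 !l10 /= expr0 expr1 mulN1r mul1r mulrN addr0.
Qed.

Lemma mxtrace2 (S : nzSemiRingType) (A : 'M[S]_2) : \tr A = A 0 0 + A 1 1.
Proof.
have l01 : lift ord0 ord0 = 1 :> 'I_2 by exact: val_inj.
by rewrite /mxtrace !big_ord_recl big_ord0 addr0 l01.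
Qed.

Lemma eigenvalue_mx2 (F : fieldType) (A : 'M[F]_2) a :
  eigenvalue A a = (a ^+ 2 - \tr A * a + \det A == 0).
Proof.
rewrite eigenvalue_root_char /char_poly rootE !det_mx2 mxtrace2 !mxE/=.
rewrite !(hornerD, hornerN, hornerM, hornerX, hornerC); congr (_ == 0); ring.
Qed.

Section Hyperbolic.
Context {R : realType} {g : 'M[int]_2}.
Hypotheses (gSL : SL2Z g) (ghyp : hyperbolic g).

Let x : R := Num.sqrt ((\tr g) ^+ 2 - 4)%:~R.
Let eps : R := eps_eigenvalue R g.
Local Notation O := (ring_of_integers (trace_field R g)).

Let tr_ge3 : 3 <= `|\tr g| :> int.
Proof. by move: ghyp; rewrite /hyperbolic; lia. Qed.

Let disc_gt0 : 0 < (\tr g) ^+ 2 - 4.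
Proof. by move: tr_ge3; nia. Qed.

Lemma trace_field_gen_sqr : x ^+ 2 = ((\tr g) ^+ 2 - 4)%:~R.
Proof. by rewrite sqr_sqrtr// ler0z ltW. Qed.

Lemma trace_field_gen_sqr_rat : x ^+ 2 = ratr ((\tr g) ^+ 2 - 4)%:~R.
Proof. by rewrite trace_field_gen_sqr ratr_int. Qed.

(** A rational value would be an integer [z] with [z^2 + 4 = t^2], where [t] is the trace. The only
    squares at distance 4 are 0 and 4, which [|t| >= 3] excludes. *)
Lemma trace_field_gen_irrational : irrational x.
Proof.
move=> r xr; have : integralOver (intr : int -> R) (ratr r).
  rewrite -xr; apply: (@integral_root_monic _ _ intr _ ('X^2 - (((\tr g) ^+ 2 - 4)%:~R)%:P)).
  - by rewrite monicE lead_coefXnsubC.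
  - by rewrite rootE !hornerE trace_field_gen_sqr subrr.
  - apply/integral_poly => i; rewrite coefB coefXn coefC.
    apply: (@integral_sub _ _ intr); first exact: integral_nat.
    by case: ifP => _; [exact: integral_id|exact: mxpoly.integral0].
move=> /integral_ratr[z rz]; have := trace_field_gen_sqr.
rewrite xr rz ratr_int -rmorphXn => /intr_inj zt.
have {}zt : `|z| ^+ 2 + 4 = `|\tr g| ^+ 2 by rewrite !real_normK ?num_real// zt subrK.
move: tr_ge3 (normr_ge0 z) zt; move: `|\tr g| `|z| => a b a3 b0 ab.
have ba : b + 1 <= a by nia.
by nia.
Qed.

Lemma eps_eigenvalueP : [/\ 1 < `|eps|, unit_of O eps &
  `|eps| ^+ 2 = `|(\tr g)%:~R| * `|eps| - 1].
Proof.
have trE : \tr (map_mx intr g : 'M[R]_2) = (\tr g)%:~R by rewrite !mxtrace2 !mxE intrD.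
have detE : \det (map_mx intr g : 'M[R]_2) = 1 by rewrite det_map_mx gSL.
have x2 := trace_field_gen_sqr; have x0 : 0 <= x by exact: sqrtr_ge0.
have t3 : (3 : R) <= `|(\tr g)%:~R| by rewrite -intr_norm (ler_int R 3).
(* The choice made by [xget] is meaningful only once a witness exists: the root [(t + x)/2] or
   [(t - x)/2], with the sign of the trace [t]. *)
have ex : [set e : R | eigenvalue (map_mx intr g) e /\ 1 < `|e|] !=set0.
  have [t0|t0] := leP 0 (\tr g).
    have {}t3 : (3 : R) <= (\tr g)%:~R by move: t3; rewrite ger0_norm// ler0z.
    exists (((\tr g)%:~R + x) / 2); split; last by rewrite ger0_norm; lra.
    rewrite /= eigenvalue_mx2 trE detE; apply/eqP; move: x2; rewrite intrB rmorphXn/=; nra.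
  have {}t3 : (\tr g)%:~R <= (- 3 : R) by move: t3; rewrite ltr0_norm ?ltrz0//; lra.
  exists (((\tr g)%:~R - x) / 2); split; last by rewrite ler0_norm; lra.
  rewrite /= eigenvalue_mx2 trE detE; apply/eqP; move: x2; rewrite intrB rmorphXn/=; nra.
have [] : eigenvalue (map_mx intr g) eps /\ 1 < `|eps| by apply: xgetPex ex.
rewrite eigenvalue_mx2 trE detE => /eqP eE e1.
have e0 : eps != 0 by apply: contraTneq e1 => ->; rewrite normr0 ltr10.
have eV : eps^-1 = (\tr g)%:~R - eps by apply: (mulIf e0); rewrite mulVf//; lra.
(* Completing the square places [eps] at [t/2 + x/2] or [t/2 - x/2]. *)
have Ke : adjoin_rat x eps.
  have : (eps - (\tr g)%:~R / 2) ^+ 2 = (x / 2) ^+ 2.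
    by rewrite exprMn x2 intrB rmorphXn/=; nra.
  have hx : adjoin_rat x (x / 2).
    by apply: adjoin_rat_div => //; exact: (adjoin_rat_int x 2).
  have ht : adjoin_rat x ((\tr g)%:~R / 2).
    by apply: adjoin_rat_div; [exact: adjoin_rat_int|exact: (adjoin_rat_int x 2)].
  move/eqP; rewrite eqf_sqr => /orP[] /eqP/(canRL (subrK _)) ->; apply: adjoin_ratD => //.
  exact: adjoin_ratN.
have Ie : integralOver (intr : int -> R) eps.
  exists ('X^2 - ((\tr g) *: 'X - 1)); last first.
    rewrite rootE !(rmorphB, rmorph1)/= map_polyXn map_polyZ/= map_polyX.
    by rewrite !(hornerD, hornerN, hornerZ, hornerXn, hornerX, hornerC) -eE; apply/eqP; ring.
  rewrite monicE lead_coefDl ?lead_coefXn// size_polyN size_polyXn.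
  rewrite (leq_ltn_trans (size_polyD _ _))// gtn_max size_polyN size_poly1 andbT.
  by rewrite (leq_ltn_trans (size_scale_leq _ _)) ?size_polyX.
split=> //.
  split=> //; rewrite eV; split; first by apply: adjoin_ratB => //; exact: adjoin_rat_int.
  by apply: (@integral_sub _ _ intr) => //; exact: integral_id.
(* Taking absolute values on both sides of this identity removes the sign of the trace. *)
have te : eps ^+ 2 + 1 = (\tr g)%:~R * eps by lra.
have := congr1 Num.norm te; rewrite normrM [LHS]ger0_norm ?addr_ge0 ?sqr_ge0// => <-.
by rewrite real_normK ?num_real// addrK.
Qed.

End Hyperbolic.

(** * Units of norm -1 *)

Lemma ord2P (k : 'I_2) : k = 0 \/ k = 1.
Proof. by case: k => -[|[|//]] k2; [left|right]; exact: val_inj. Qed.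

(** The recurrence [a_(n+2) = z a_(n+1) - a_n] for [a_n = e^n + e^-n] propagates integrality, so two
    consecutive terms are carried along. *)
Lemma power_trace_int {R : realType} (e : R) (z : int) n : e != 0 ->
  e + e^-1 = z%:~R -> exists w : int, e ^+ n + e ^- n = w%:~R.
Proof.
move=> e0 ez.
suff [[w wE] _] : (exists w : int, e ^+ n + e ^- n = w%:~R) /\
  (exists w : int, e ^+ n.+1 + e ^- n.+1 = w%:~R) by exists w.
elim: n => [|n [[w wE] [v vE]]].
  by split; [exists 2; rewrite !expr0 invr1|exists z; rewrite !expr1].
split; first by exists v.
exists (z * v - w); rewrite intrB intrM -ez -wE -vE !exprS; field.
by rewrite e0 expf_neq0.
Qed.

(** The norm is defined through a basis of unspecified size; this fixes the size. In the coordinates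
    given by 1 and [x], the basis becomes an [n] by 2 matrix [P]; independence makes [P] row free,
    generation makes it row full, so [n] is its rank 2. *)
Lemma rat_basis_adjoin_rat_size {R : realType} {x : R} {d : rat} n (b : 'I_n -> R) :
  x ^+ 2 = ratr d -> irrational x -> rat_basis (adjoin_rat x) b -> n = 2%N.
Proof.
move=> xd irr [bK binj bsurj].
have eq0 (p q : rat) : ratr p + ratr q * x = 0 -> p = 0 /\ q = 0.
  have [->|q0 h] := eqVneq q 0.
    by rewrite rmorph0 mul0r addr0 => /eqP; rewrite fmorph_eq0 => /eqP.
  exfalso; apply: (irr (- p / q)); rewrite rmorphM rmorphN fmorphV/=.
  by apply: (canRL (mulfK _)); [rewrite fmorph_eq0|lra].
have bpq i : {pq : rat * rat | b i = ratr pq.1 + ratr pq.2 * x}.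
  apply: cid; have : adjoin_rat x (b i).
    have := bK (delta_mx 0 i) I; rewrite (bigD1 i)//= mxE !eqxx/= rmorph1 mul1r.
    rewrite big1 ?addr0// => j ji; rewrite mxE eqxx (negbTE ji)/=.
    by rewrite rmorph0 mul0r.
  by move=> /(adjoin_rat_sqrt _ _ _ xd)[p [q pq]]; exists (p, q).
pose P : 'M[rat]_(n, 2) := \matrix_(i, j) (if j == 0 then (sval (bpq i)).1 else (sval (bpq i)).2).
have coord (c : 'rV[rat]_n) :
    \sum_(i < n) ratr (c 0 i) * b i = ratr ((c *m P) 0 0) + ratr ((c *m P) 0 1) * x.
  rewrite !mxE !rmorph_sum mulr_suml -big_split/=; apply: eq_bigr => i _.
  by rewrite !mxE/= {1}(svalP (bpq i)) !rmorphM/=; ring.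
have Pfree : row_free P.
  apply: inj_row_free => v vP; apply: binj; rewrite ?inE// !coord vP mul0mx.
  by rewrite !mxE.
have Pfull : row_full P.
  rewrite -sub1mx; apply/row_subP => j; apply/submxP.
  have Kj : adjoin_rat x (ratr (j == 0)%:R + ratr (j == 1)%:R * x).
    have [->|->] := ord2P j; rewrite /= ?(rmorph0, rmorph1).
      by rewrite mul0r addr0; exact: adjoin_rat1.
    by rewrite mul1r add0r.
  have [c _] := bsurj _ Kj; rewrite coord => cj; exists c.
  have [h0 h1] : (c *m P) 0 0 - (j == 0)%:R = 0 /\ (c *m P) 0 1 - (j == 1)%:R = 0.
    by apply: eq0; rewrite !rmorphB/=; lra.
  apply/matrixP => i k; rewrite ord1 mxE [LHS]mxE.
  by have [->|->] := ord2P k; [move/subr0_eq: h0|move/subr0_eq: h1].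
by rewrite -(eqP Pfree); exact/eqP.
Qed.

(* A unit of norm -1 is a root of [X^2 - tX - 1] for a rational [t], whereas
   the powers [u] of an eigenvalue of [g] have [u + 1/u] rational. *)
Lemma norm_neg1_not_fundamental {R : realType} {g : 'M[int]_2} (u : R) :
  SL2Z g -> hyperbolic g ->
  unit_of (ring_of_integers (trace_field R g)) u ->
  has_field_norm (trace_field R g) u (-1) ->
  `|eps_eigenvalue R g| != fundamental_unit (trace_field R g).
Proof.
move=> gSL ghyp Uu [n [b [M [bbasis Mb detM]]]]; apply/eqP => epsE.
have [eps1 Ueps epsq] := @eps_eigenvalueP R g gSL ghyp.
have xd := @trace_field_gen_sqr_rat R g ghyp.
have irrx := @trace_field_gen_irrational R g ghyp.
have n2 := rat_basis_adjoin_rat_size _ _ xd irrx bbasis.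
have [_ binj _] := bbasis.
subst n.
have sum2 (c : 'I_2 -> rat) : \sum_(i < 2) ratr (c i) * b i = ratr (c 0) * b 0 + ratr (c 1) * b 1.
  by rewrite big_ord_recl big_ord1; congr (_ + ratr (c _) * b _); exact: val_inj.
have indep (p q : rat) : ratr p * b 0 + ratr q * b 1 = 0 -> p = 0 /\ q = 0.
  move=> pq; have h : (\row_(i < 2) if i == 0 then p else q) = (0 : 'rV[rat]_2).
    apply: binj; rewrite ?inE// !sum2 !mxE/= pq !rmorph0; ring.
  by split; [have := congr1 (fun v : 'rV_2 => v 0 0) h|have := congr1 (fun v : 'rV_2 => v 0 1) h]; rewrite !mxE.
have M0 := Mb 0; have M1 := Mb 1; rewrite !sum2 in M0 M1.
have b0 : b 0 != 0.
  apply/eqP => b00; have [] := indep 1 0; last by move/eqP; rewrite oner_eq0.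
  by rewrite b00 rmorph0 mul0r mulr0 addr0.
(* Cayley-Hamilton for [M], obtained by eliminating [b 1] from the two relations and cancelling
   [b 0]. *)
have uq : u ^+ 2 = ratr (\tr M) * u + 1.
  have {1}-> : (1 : R) = - ratr (\det M) by rewrite -detM rmorphN rmorph1 opprK.
  rewrite mxtrace2 det_mx2 rmorphD rmorphB !rmorphM/=.
  apply: (mulIf b0).
  have h : (u - ratr (M 1 1)) * (u * b 0) =
      (u - ratr (M 1 1)) * (ratr (M 0 0) * b 0) + ratr (M 0 1) * (ratr (M 1 0) * b 0).
    rewrite M0; have -> : ratr (M 1 0) * b 0 = u * b 1 - ratr (M 1 1) * b 1 by rewrite M1; ring.
    by ring.
  lra.
(* If [u] were 1 or -1, then [M] would be the scalar matrix [u], of determinant 1. *)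
have u1 : `|u| != 1.
  apply/eqP => u1; have [w uw ww] : exists2 w : rat, u = ratr w & w * w = 1.
    move/eqP: u1; rewrite eqr_norml ler01 andbT => /orP[] /eqP ->.
      by exists 1; rewrite ?rmorph1.
    by exists (-1); rewrite ?rmorphN ?rmorph1// mulrNN mulr1.
  have [h00 h01] := indep (M 0 0 - w) (M 0 1) ltac:(rewrite rmorphB/= -uw; lra).
  have [h10 h11] := indep (M 1 0) (M 1 1 - w) ltac:(rewrite rmorphB/= -uw; lra).
  move: detM; rewrite det_mx2 h01 mul0r subr0 (subr0_eq h00) (subr0_eq h11) ww.
  by move/eqP; rewrite eq_sym -addr_eq0.
have irru : irrational u.
  by case: (unitsO_quadratic _ _ _ xd Uu) => [/eqP|[]//]; rewrite (negbTE u1).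
have fundE : is_fundamental_unit (trace_field R g) (fundamental_unit (trace_field R g)).
  have [e ee] := exists_fundamental_unit xd _ (unitsO_norm _ _ Ueps) eps1.
  by rewrite (fundamental_unitE ee).
have u0 : u != 0 by case: Uu.
(* If [|eps|] is fundamental, then [|u|] or its inverse is a power of [|eps|], and [|eps| + 1/|eps|]
   is the integer [|tr g|]. *)
have [z uz] : exists z : int, `|u| + `|u|^-1 = z%:~R.
  have eps0 : `|eps_eigenvalue R g| != 0 by rewrite gt_eqF// (lt_trans ltr01).
  have [v [Uv v1] vz] : exists2 v : R, unit_of (ring_of_integers (trace_field R g)) v /\ 1 < v &
      `|u| = v \/ `|u| = v^-1.
    have [lt1|gt1|/eqP] := ltgtP 1 `|u|; last by rewrite eq_sym (negbTE u1).
      by exists `|u|; [split=> //; exact: unitsO_norm|left].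
    exists `|u|^-1; last by right; rewrite invrK.
    split; first by apply: unitsOV; exact: unitsO_norm.
    by rewrite invf_gt1 ?normr_gt0.
  have [k _ vk] := unit_gt1_power xd _ _ fundE Uv v1.
  have [|w wE] := power_trace_int _ `|\tr g| k eps0.
    by rewrite intr_norm; apply: (mulIf eps0); rewrite mulrDl mulVf// -expr2 epsq subrK.
  exists w; rewrite -wE; case: vz => ->; rewrite vk -epsE ?invrK//.
  by rewrite addrC.
have uV : u^-1 = u - ratr (\tr M) by apply: (mulIf u0); rewrite mulVf//; lra.
have [s us] : exists s : int, u + u^-1 = s%:~R.
  have [u_ge0|u_lt0] := ger0P u; first by exists z; rewrite -uz ger0_norm.
  by exists (- z); rewrite intrN -uz ltr0_norm// invrN; ring.
(* From [u - 1/u = tr M] and [u + 1/u = s], the number [u] is the rational [(s + tr M)/2]. *)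
apply: (irru ((s%:~R + \tr M) / 2)); rewrite rmorphM rmorphD fmorphV/= ratr_int ratr_nat.
by lra.
Qed.

(** * Counting matrices *)

(* The larger root of [X^2 - sX + (-1)^b]. *)
Definition quad_root (R : realType) (s : nat) (b : bool) : R :=
  (s%:R + Num.sqrt (s%:R ^+ 2 - 4 * (-1) ^+ b)) / 2.

(** This makes the exceptional traces enumerable: up to sign, such a trace is determined by the
    discrete data [s], [b], [n]. The floor turns the real expression, already an integer here, into
    an element of [int]. *)
Lemma nonfundamental_trace {R : realType} {g : 'M[int]_2} :
  SL2Z g -> hyperbolic g ->
  `|eps_eigenvalue R g| != fundamental_unit (trace_field R g) ->
  exists s b n, let e := quad_root R s b in
    [/\ s%:R <= e + 1, 1 < e, 2 < e ^+ 2, (1 < n)%N &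
      e ^+ n <= `|\tr g|%:~R /\ `|\tr g| = Num.floor (e ^+ n + e ^- n)].
Proof.
move=> gSL ghyp neq; have [eps1 Ueps epsq] := @eps_eigenvalueP R g gSL ghyp.
have xd := @trace_field_gen_sqr_rat R g ghyp.
have {}Ueps := unitsO_norm _ _ Ueps.
have [e ee] := exists_fundamental_unit xd _ Ueps eps1.
have [[Ue e1] _] := ee.
have [n n0 en] := unit_gt1_power xd _ _ ee Ueps eps1.
have [s [z [s0 zE eq]]] := unit_gt1_quadratic xd _ Ue e1.
have e0 : e != 0 by case: Ue.
have e_gt0 := lt_trans ltr01 e1.
have eE : e = quad_root R `|s|%N (z == -1).
  have sE : (`|s|%N%:R : R) = s%:~R by rewrite pmulrn gez0_abs// ltW.
  (* The discriminant is [(2e - s)^2], and [2e - s] is nonnegative because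
     [(2e - s) e = e^2 - z]. *)
  rewrite /quad_root sE (_ : _ - _ = (2 * e - s%:~R) ^+ 2).
    rewrite sqrtr_sqr ger0_norm; first by field.
    have : 0 <= (2 * e - s%:~R) * e.
      by case: zE eq => -> eq; nra.
    by rewrite pmulr_lge0.
  have -> : (-1) ^+ (z == -1) = z%:~R :> R.
    by case: zE => ->; rewrite ?eqxx /= ?expr0 ?expr1 ?intrN.
  by nra.
exists `|s|%N, (z == -1), n => /=; rewrite -eE; split=> //.
- rewrite pmulrn gez0_abs ?(ltW s0)//.
  suff : s%:~R * e <= (e + 1) * e by rewrite (ler_pM2r e_gt0).
  by case: zE eq => -> eq; nra.
- exact: (unit_gt1_sqr xd).
(* The exponent 1 would make [|eps|] the fundamental unit. *)
- case: n n0 en => [|[|n]] // _; rewrite expr1 => en; case/eqP: neq.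
  by rewrite en (fundamental_unitE ee).
have tE : `|\tr g|%:~R = e ^+ n + e ^- n :> R.
  rewrite -en intr_norm; have eps0 := lt0r_neq0 (lt_trans ltr01 eps1).
  by apply: (mulIf eps0); rewrite mulrDl mulVf// -expr2 epsq subrK.
rewrite tE lerDl invr_ge0 exprn_ge0 ?(ltW e_gt0)//; split=> //.
by rewrite -tE intrKfloor.
Qed.

(** * Matrices with a given trace *)

Definition mx2 (a b c d : int) : 'M[int]_2 :=
  \matrix_(i, j) if i == 0 then (if j == 0 then a else b) else (if j == 0 then c else d).

Lemma mx2E (g : 'M[int]_2) : g = mx2 (g 0 0) (g 0 1) (g 1 0) (g 1 1).
Proof.
by apply/matrixP => i j; rewrite mxE; have [->|->] := ord2P i; have [->|->] := ord2P j.
Qed.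

Definition ints (N : nat) : seq int := [seq i%:Z - N%:Z | i <- iota 0 (2 * N).+1].

Lemma mem_ints N (a : int) : `|a| <= N%:Z -> a \in ints N.
Proof.
move=> aN; apply/mapP; exists `|(a + N%:Z)%R|%N; last by lia.
by rewrite mem_iota; lia.
Qed.

Lemma size_ints N : size (ints N) = (2 * N).+1.
Proof. by rewrite size_map size_iota. Qed.

Definition factor_pairs (m : int) : seq (int * int) :=
  [seq (d%:Z, (m %/ d%:Z)%Z) | d <- divisors `|m|%N] ++
  [seq (- d%:Z, (m %/ - d%:Z)%Z) | d <- divisors `|m|%N].

Lemma mem_factor_pairs (b c : int) : b * c != 0 -> (b, c) \in factor_pairs (b * c).
Proof.
move=> bc0; have b0 : b != 0 by apply: contraNneq bc0 => ->; rewrite mul0r.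
have db : `|b|%N \in divisors `|(b * c)%R|%N.
  by rewrite -dvdn_divisors ?absz_gt0// abszM dvdn_mulr.
have cE : (b * c %/ b)%Z = c by rewrite mulrC mulzK.
rewrite mem_cat; have [b_ge0|b_lt0] := lerP 0 b; apply/orP.
  by left; apply/mapP; exists `|b|%N; rewrite // gez0_abs// cE.
by right; apply/mapP; exists `|b|%N; rewrite // ltz0_abs// opprK cE.
Qed.

Lemma size_factor_pairs m : size (factor_pairs m) = (2 * size (divisors `|m|%N))%N.
Proof. by rewrite size_cat !size_map; lia. Qed.

(* Covers the matrices with [b c != 0] only: [factor_pairs 0] is junk, and the
   case [b c = 0] is left to [unipotents]. *)
Definition trace_fiber (N : nat) (t : int) : seq 'M[int]_2 :=
  [seq mx2 a bc.1 bc.2 (t - a) |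
    a <- [seq a <- ints N | (`|(a * (t - a) - 1)%R| <= N ^ 2)%N],
    bc <- factor_pairs (a * (t - a) - 1)].

Definition unipotents (N : nat) : seq 'M[int]_2 :=
  [seq mx2 a 0 x a | a <- [:: 1; -1], x <- ints N] ++
  [seq mx2 a x 0 a | a <- [:: 1; -1], x <- ints N].

Lemma mem_trace_fiber N (g : 'M[int]_2) : SL2Z g ->
  (forall i j, `|g i j| <= N%:Z) ->
  (g \in unipotents N) || (g \in trace_fiber N (\tr g)).
Proof.
move=> gSL gN; have dg := det_mx2 _ g; rewrite gSL in dg; have := mxtrace2 _ g.
rewrite [g in g \in unipotents N]mx2E [g in g \in trace_fiber _ _]mx2E.
move: dg (gN 0 0) (gN 0 1) (gN 1 0) (gN 1 1).
move: (g 0 0) (g 0 1) (g 1 0) (g 1 1) (\tr g) => a b c d t dg aN bN cN dN tE.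
have {tE}dE : d = t - a by rewrite tE addrC addKr.
have bcE : a * (t - a) - 1 = b * c by rewrite -dE dg; ring.
have [bc0|bc0] := eqVneq (b * c) 0; apply/orP.
  (* Here the matrix is triangular and [a d = 1], so [a = d] is 1 or -1. *)
  left; have da : a * d = 1 by rewrite dg bc0 subr0.
  have [aE dE'] : a = d /\ a \in [:: 1; -1].
    have /eqP := congr1 absz da; rewrite abszM muln_eq1 !inE => /andP[/eqP ? /eqP ?].
    by split; [nia|lia].
  rewrite mem_cat -aE; move/eqP: bc0; rewrite mulf_eq0 => /orP[] /eqP ->; apply/orP.
    by left; apply/allpairsP; exists (a, c); rewrite /= mem_ints.
  by right; apply/allpairsP; exists (a, b); rewrite /= mem_ints.
right; apply/allpairsPdep; exists a, (b, c); rewrite dE; split=> //.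
  rewrite mem_filter mem_ints// andbT bcE abszM expnS expn1 leq_mul//; lia.
by rewrite bcE mem_factor_pairs.
Qed.

Lemma sumn_map_leq (T : eqType) (s : seq T) (f : T -> nat) k :
  (forall a, a \in s -> f a <= k)%N -> (sumn (map f s) <= size s * k)%N.
Proof.
elim: s => //= a s IHs fk; rewrite mulSn leq_add ?fk ?mem_head//.
by apply: IHs => b bs; rewrite fk// in_cons bs orbT.
Qed.

(** There are at most [2N + 1] entries [a], and the filter in [trace_fiber] keeps [|a (t - a) - 1|]
    in the range where the hypothesis on divisors applies. *)
Lemma size_trace_fiber N t D :
  (forall m, m <= N ^ 2 -> size (divisors m) <= D)%N ->
  (size (trace_fiber N t) <= (2 * N).+1 * (2 * D))%N.
Proof.
move=> dD; rewrite size_allpairs_dep.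
apply: (@leq_trans (size [seq a <- ints N | (`|(a * (t - a) - 1)%R| <= N ^ 2)%N] * (2 * D))).
  apply: sumn_map_leq => a; rewrite mem_filter => /andP[aN _].
  by rewrite size_factor_pairs leq_mul// dD.
by rewrite leq_mul// size_filter (leq_trans (count_size _ _))// size_ints.
Qed.

Lemma size_unipotents N : size (unipotents N) = (4 * (2 * N).+1)%N.
Proof. by rewrite size_cat !size_allpairs !size_ints/=; lia. Qed.

Lemma card_fset_set_le_size (T : choiceType) (A : set T) (s : seq T) :
  A `<=` [set` s] -> (#|` fset_set A| <= size s)%N.
Proof.
move=> As; have fA : finite_set A by apply: (sub_finite_set As); exact: finite_seq.
apply: (@leq_trans #|` seq_fset tt s|); last by rewrite size_seq_fset size_undup.
apply: fsubset_leq_card; apply/fsubsetP => a.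
by rewrite in_fset_set// inE => /As; rewrite seq_fsetE.
Qed.

Lemma size_le_card_fset_set (T : choiceType) (A : set T) (s : seq T) :
  finite_set A -> uniq s -> [set` s] `<=` A -> (size s <= #|` fset_set A|)%N.
Proof.
move=> fA us sA; rewrite cardfE; apply: (@leq_trans #|` seq_fset tt s|).
  by rewrite size_seq_fset undup_id.
rewrite -cardfE; apply: fsubset_leq_card; apply/fsubsetP => a.
by rewrite seq_fsetE in_fset_set// inE; exact: sA.
Qed.

(** * The divisor bound *)

(** Each divisor is the product of its [p]-part, [p ^ i] with [i <= a], and its prime-to-[p] part,
    which divides [m]. *)
Lemma size_divisors_pfactor p a m : prime p -> (0 < m)%N -> ~~ (p %| m)%N ->
  (size (divisors (p ^ a * m)) <= a.+1 * size (divisors m))%N.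
Proof.
move=> pp m0 pm; have n0 : (0 < p ^ a * m)%N by rewrite muln_gt0 expn_gt0 prime_gt0.
pose s := [seq (p ^ i * d)%N | i <- iota 0 a.+1, d <- divisors m].
have <- : size s = (a.+1 * size (divisors m))%N by rewrite size_allpairs size_iota.
apply: uniq_leq_size; first exact: divisors_uniq.
move=> d; rewrite -dvdn_divisors// => dn.
have d0 := dvdn_gt0 n0 dn.
apply/allpairsP; exists (logn p d, (d`_p^')%N); split.
- rewrite mem_iota add0n ltnS; have := dvdn_leq_log p n0 dn.
  have pa0 : (0 < p ^ a)%N by rewrite expn_gt0 prime_gt0.
  by rewrite (lognM p pa0 m0) (pfactorK a pp) (lognE p m) (negbTE pm) !andbF addn0.
- rewrite -dvdn_divisors//; have : (d`_p^' %| p ^ a * m)%N by rewrite (dvdn_trans (dvdn_part _ _)).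
  rewrite Gauss_dvdr// coprimeXr//; apply: (pnat_coprime (part_pnat _ _)).
  by rewrite pnatNK pnat_id.
- by rewrite -p_part partnC.
Qed.

(* The prime factors [p] with [p `^ delta >= 2] contribute at most 1 to
   [d(n) / n `^ delta], the finitely many others at most [A] each. *)
Lemma divisor_bound (R : realType) (delta : R) : 0 < delta ->
  exists2 C : R, 0 < C &
    forall n, (0 < n)%N -> (size (divisors n))%:R <= C * n%:R `^ delta.
Proof.
move=> delta0; have ln2 : 0 < ln 2 :> R by rewrite ln_gt0 ?ltr1n.
pose A : R := 1 + (delta * ln 2)^-1.
have A1 : 1 <= A by rewrite lerDl invr_ge0 ltW// mulr_gt0.
pose P := Num.bound ((2 : R) `^ delta^-1).
(* Expanding [A (1 + a delta ln 2)] gives [a + 1] plus nonnegative terms; then [1 + y <= exp y] and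
   [p >= 2] conclude. *)
have A_bound a p : (1 < p)%N -> a.+1%:R <= A * (p ^ a)%:R `^ delta.
  move=> p1; apply: (@le_trans _ _ (A * (1 + a%:R * (delta * ln 2)))).
    have dl : 0 < delta * ln 2 by rewrite mulr_gt0.
    have -> : A * (1 + a%:R * (delta * ln 2)) =
        a%:R + 1 + (a%:R * (delta * ln 2) + (delta * ln 2)^-1).
      by rewrite /A; field; rewrite !gt_eqF.
    by rewrite natr1 lerDl addr_ge0 ?invr_ge0 ?mulr_ge0// ltW.
  rewrite ler_pM2l ?(lt_le_trans _ A1)//; apply: (le_trans (expR_ge1Dx _)).
  rewrite /powR gt_eqF ?ltr0n ?expn_gt0 ?(ltnW p1)// ler_expR natrX lnXn ?ltr0n ?(ltnW p1)//.
  rewrite -[ln _ *+ a]mulr_natl mulrCA ler_pM2l// ler_wpM2l// ler_ln ?posrE ?ltr0n ?(ltnW p1)//.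
  by rewrite ler_nat.
(* Here [p ^ delta >= 2], and [a + 1 <= 2^a]. *)
have big_prime a p : (P <= p)%N -> a.+1%:R <= (p ^ a)%:R `^ delta.
  move=> Pp; have p2 : 2 <= p%:R `^ delta.
    have -> : (2 : R) = (2 `^ delta^-1) `^ delta by rewrite -powRrM mulVf ?gt_eqF// powRr1.
    rewrite ge0_ler_powR ?nnegrE ?powR_ge0// ?(ltW delta0)//.
    by apply: (le_trans (ltW (archi_boundP (powR_ge0 _ _)))); rewrite ler_nat.
  rewrite natrX -powR_mulrn// -powRrM mulrC powRrM powR_mulrn ?powR_ge0//.
  apply: (@le_trans _ _ (2 ^+ a)); last by rewrite lerXn2r ?nnegrE ?powR_ge0.
  by rewrite -natrX ler_nat ltn_expl.
(* Induction on a strict bound [k] for the prime factors; the exponent [minn k P] charges one factor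
   [A] to each integer below both [k] and [P]. *)
have main k n : (0 < n)%N -> (forall p, p \in primes n -> p < k)%N ->
    (size (divisors n))%:R <= A ^+ minn k P * n%:R `^ delta.
  elim: k n => [|k IHk] n n0 pk.
    have -> : n = 1%N.
      case: n n0 pk => [|[|n]]// _ /(_ (pdiv n.+2)).
      by rewrite mem_primes pdiv_prime//= pdiv_dvd => /(_ isT).
    by rewrite min0n expr0 powR1 mul1r.
  have Amono : A ^+ minn k P <= A ^+ minn k.+1 P.
    by rewrite ler_weXn2l// leq_min geq_minr (leq_trans (geq_minl _ _)).
  have [kn|kn] := boolP (k \in primes n); last first.
    apply: (le_trans (IHk n n0 _)).
      move=> p pn; have := pk p pn; rewrite ltnS leq_eqVlt => /predU1P[pk'|//].
      by rewrite -pk' pn in kn.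
    by rewrite ler_wpM2r ?powR_ge0.
  have kp : prime k by move: kn; rewrite mem_primes => /andP[].
  have k1 := prime_gt1 kp.
  have m0 := part_gt0 (k^')%N n; set m := (n`_k^')%N in m0.
  have nE : n = (k ^ logn k n * m)%N by rewrite -p_part partnC.
  have km : ~~ (k %| m)%N.
    by apply/negP => /(pnatP _ m0 (part_pnat _ n) _ kp); rewrite !inE eqxx.
  have := IHk m m0; have /[swap] /[apply] : forall p, p \in primes m -> (p < k)%N.
    move=> p; rewrite mem_primes => /and3P[pp _ pm].
    have := pk p; rewrite mem_primes pp n0 nE dvdn_mull// => /(_ isT).
    rewrite ltnS leq_eqVlt => /predU1P[pk'|//].
    by rewrite -pk' pm in km.
  move=> dm; rewrite nE natrM powRM//.
  have := size_divisors_pfactor _ (logn k n) _ kp m0 km; rewrite -(ler_nat R) => /le_trans; apply.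
  rewrite natrM; move: dm; set D := (size _)%:R; move=> dm.
  have D0 : 0 <= D by [].
  have pm0 : 0 <= m%:R `^ delta by exact: powR_ge0.
  have pk0 : 0 <= (k ^ logn k n)%:R `^ delta by exact: powR_ge0.
  have Am0 : 0 <= A ^+ minn k P by rewrite exprn_ge0// (le_trans ler01).
  have [kP|Pk] := ltnP k P.
    rewrite (minn_idPl kP) (minn_idPl (ltnW kP)) in dm *.
    have := ler_pM _ _ (A_bound (logn k n) k k1) dm => /(_ (ler0n _ _) D0)/le_trans; apply.
    by rewrite exprS -!mulrA [X in _ <= A * X]mulrCA.
  rewrite (minn_idPr (leqW Pk)) (minn_idPr Pk) in dm *.
  have := ler_pM _ _ (big_prime (logn k n) k Pk) dm => /(_ (ler0n _ _) D0)/le_trans; apply.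
  by rewrite mulrCA.
exists (A ^+ P); first by rewrite exprn_gt0// (lt_le_trans ltr01).
move=> n n0; have := main n.+1 n n0; have /[swap] /[apply] : forall p, p \in primes n -> (p < n.+1)%N.
  by move=> p; rewrite mem_primes ltnS => /and3P[_ _ /dvdn_leq]; apply.
by move=> /le_trans; apply; rewrite ler_wpM2r ?powR_ge0// ler_weXn2l// geq_minr.
Qed.

(** * Lower bound for the size of the ball *)

(** The sum telescopes: [1/d^2 <= 1/(d-1) - 1/d] for [d >= 3], while the term [d = 2] is
    [1/4 = 3/4 - 1/2]. *)
Lemma sum_sqr_divn N M : (1 < M)%N ->
  \sum_(2 <= d < M.+1) ((N %/ d) ^ 2)%:R <= N%:R ^+ 2 * (3%:R / 4%:R - M%:R^-1) :> rat.
Proof.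
have divn_le d : (0 < d)%N -> ((N %/ d) ^ 2)%:R <= N%:R ^+ 2 / d%:R ^+ 2 :> rat.
  move=> d0; rewrite natrX -expr_div_n lerXn2r ?nnegrE ?divr_ge0//.
  by rewrite ler_pdivlMr ?ltr0n// -natrM ler_nat leq_trunc_div.
elim: M => // -[|[|M]] IHM // _.
  by rewrite big_nat1; apply: (le_trans (divn_le _ _)).
rewrite big_nat_recr//=; apply: (le_trans (lerD (IHM isT) (divn_le _ _))) => //.
rewrite -mulrDr ler_wpM2l ?sqr_ge0// -[M.+3%:R]natr1 -addrA lerD2l.
have : (0 : rat) < M.+2%:R by rewrite ltr0n.
move: M.+2%:R => y y0; rewrite -subr_ge0.
have -> : - (y + 1)^-1 - (- y^-1 + ((y + 1) ^+ 2)^-1) = (y * (y + 1) ^+ 2)^-1.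
  by field; rewrite !gt_eqF// addr_gt0.
by rewrite invr_ge0 mulr_ge0 ?sqr_ge0 ?ltW.
Qed.

Definition box (N : nat) : seq (nat * nat) :=
  [seq (a, c) | a <- iota 1 N, c <- iota 1 N].

Definition coprime_box (N : nat) : seq (nat * nat) :=
  [seq p <- box N | coprime p.1 p.2].

Lemma box_uniq N : uniq (box N).
Proof. by rewrite allpairs_uniq ?iota_uniq// => -[a b] [c d] _ _ [-> ->]. Qed.

(* Union bound over the common divisors [d >= 2], using [sum 1/d^2 <= 3/4]. *)
Lemma size_coprime_box N : (N ^ 2 <= 4 * size (coprime_box N))%N.
Proof.
have [|N2] := leqP N 1.
  by case: N => [|[|//]].
pose nc := [seq p <- box N | ~~ coprime p.1 p.2].
have splitN : (size (coprime_box N) + size nc = N ^ 2)%N.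
  by rewrite !size_filter count_predC size_allpairs size_iota expnS expn1.
have nc_le : (size nc <= \sum_(2 <= d < N.+1) (N %/ d) ^ 2)%N.
  (* Pairs in the box divisible by [d] are the multiples by [d] of the pairs in the box of side
     [N %/ d]; a non-coprime pair is found at [d] equal to its gcd. *)
  pose s := flatten [seq [seq (d * q.1, d * q.2)%N | q <- box (N %/ d)] | d <- index_iota 2 N.+1].
  have <- : size s = (\sum_(2 <= d < N.+1) (N %/ d) ^ 2)%N.
    rewrite size_flatten /shape -map_comp sumnE big_map; apply: eq_bigr => d _.
    by rewrite /= size_map size_allpairs size_iota expnS expn1.
  apply: uniq_leq_size; first by rewrite filter_uniq// box_uniq.
  move=> [a c]; rewrite mem_filter => /andP[/= ac /allpairsP[[a' c'] /= [aN cN [? ?]]]]; subst a' c'.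
  move: aN cN; rewrite !mem_iota !add1n !ltnS => /andP[a0 aN] /andP[c0 cN].
  have g0 : (0 < gcdn a c)%N by rewrite gcdn_gt0 a0.
  apply/flatten_mapP; exists (gcdn a c).
    rewrite mem_index_iota ltnS (leq_trans (dvdn_leq a0 (dvdn_gcdl a c)))// andbT.
    by move: ac g0; rewrite /coprime; case: gcdn => [|[|]].
  apply/mapP; exists (a %/ gcdn a c, c %/ gcdn a c)%N; last first.
    by rewrite /= ![(gcdn a c * _)%N]mulnC !divnK ?dvdn_gcdl ?dvdn_gcdr.
  apply/allpairsP; exists (a %/ gcdn a c, c %/ gcdn a c)%N; rewrite /= !mem_iota !add1n !ltnS.
  rewrite !divn_gt0// (leq_div2r _ aN) (leq_div2r _ cN).
  by rewrite (dvdn_leq a0 (dvdn_gcdl a c)) (dvdn_leq c0 (dvdn_gcdr a c)).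
have := sum_sqr_divn N _ N2; rewrite -natr_sum => sum_le.
have {}nc_le : (4 * size nc <= 3 * N ^ 2)%N.
  rewrite -(ler_nat rat) (natrM _ 4) (natrM _ 3) natrX.
  have := nc_le; rewrite -(ler_nat rat) => /le_trans/(_ sum_le).
  have : 0 <= (N%:R : rat) ^+ 2 * N%:R^-1 by rewrite mulr_ge0 ?sqr_ge0 ?invr_ge0.
  by rewrite mulrBr; lra.
by lia.
Qed.

Lemma SL2Z_mx2 (a b c d : int) : a * d - b * c = 1 -> SL2Z (mx2 a b c d).
Proof. by rewrite /SL2Z /= det_mx2 !mxE. Qed.

Lemma frobenius_normE (R : realType) (g : 'M[int]_2) :
  frobenius_norm R g =
  Num.sqrt (g 0 0 ^+ 2 + g 0 1 ^+ 2 + g 1 0 ^+ 2 + g 1 1 ^+ 2)%:~R.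
Proof.
rewrite /frobenius_norm mxtrace2 !mxE !big_ord_recl !big_ord0 !mxE.
have -> : lift ord0 ord0 = 1 :> 'I_2 by exact: val_inj.
by congr (Num.sqrt (intr _)); ring.
Qed.

Lemma SL2Z_ball_entry (R : realType) (T : R) (g : 'M[int]_2) i j :
  SL2Z_ball T g -> `|g i j| <= (Num.truncn T)%:Z.
Proof.
move=> [_ /= gT]; have T0 : 0 <= T by apply: le_trans gT; exact: sqrtr_ge0.
suff : `|g i j|%:~R <= T.
  by move=> h; rewrite -abszE lez_nat truncn_ge_nat// pmulrn abszE.
apply: le_trans gT; rewrite frobenius_normE intr_norm -sqrtr_sqr.
apply: ler_wsqrtr; rewrite -rmorphXn ler_int.
have := sqr_ge0 (g 0 0); have := sqr_ge0 (g 0 1); have := sqr_ge0 (g 1 0); have := sqr_ge0 (g 1 1).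
by have [->|->] := ord2P i; have [->|->] := ord2P j; lia.
Qed.

(** Bezout coefficients complete each coprime pair, taken as first column, to a matrix of
    determinant 1. All four entries are at most [N], so the norm is at most [2N]; the first column
    gives injectivity. *)
Lemma card_SL2Z_ball_ge (R : realType) (T : R) (N : nat) : (2 * N)%:R <= T ->
  (N ^ 2 <= 4 * #|` fset_set (SL2Z_ball T)|)%N.
Proof.
move=> NT; apply: (leq_trans (size_coprime_box N)); rewrite leq_mul2l/=.
pose f (p : nat * nat) := let: (u, v) := egcdn p.1 p.2 in
  mx2 p.1%:Z v%:Z p.2%:Z u%:Z.
have <- : size (map f (coprime_box N)) = size (coprime_box N) by rewrite size_map.
apply: size_le_card_fset_set; first exact: finite_SL2Z_ball.
  rewrite map_inj_uniq; first by rewrite filter_uniq// box_uniq.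
  move=> [a c] [a' c']; rewrite /f /=; case: egcdn => u v; case: egcdn => u' v' h.
  have := congr1 (fun g : 'M[int]_2 => g 0 0) h; have := congr1 (fun g : 'M[int]_2 => g 1 0) h.
  by rewrite !mxE /= => -[->] [->].
move=> g /mapP[[a c]]; rewrite mem_filter => /andP[/= ac].
move=> /allpairsP[[a' c'] /= [aN cN [? ?]]]; subst a' c'.
move: aN cN; rewrite !mem_iota !add1n !ltnS => /andP[a0 aN] /andP[c0 cN].
rewrite /f /=; case: (egcdnP c a0) => u v; rewrite (eqP ac) muln1 => uv va ->.
(* From [u a = v c + 1] and [v < a]. *)
have uc : (u <= c)%N by nia.
split; first by apply: SL2Z_mx2; nia.
rewrite /= frobenius_normE !mxE /=.
have N0 : (0 : R) <= (2 * N)%:R by [].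
apply: le_trans NT; rewrite -(ger0_norm N0) -sqrtr_sqr; apply: ler_wsqrtr.
rewrite -natrX pmulrn ler_int; nia.
Qed.

(** * Exceptional traces and the matrices that have them *)

Definition power_traces (R : realType) (S L : nat) : seq int :=
  [seq ne.2 * Num.floor (quad_root R sb.1 sb.2 ^+ ne.1 + quad_root R sb.1 sb.2 ^- ne.1) |
    sb <- [seq (s, b) | s <- iota 0 S.+1, b <- [:: true; false]],
    ne <- [seq (n, e) | n <- iota 0 L.+1, e <- [:: 1; -1]]].

(** The five listed integers are the non-hyperbolic traces. *)
Definition small_traces (R : realType) (S L : nat) : seq int :=
  [:: -2; -1; 0; 1; 2] ++ power_traces R S L.

Lemma size_small_traces (R : realType) S L :
  size (small_traces R S L) = (5 + 4 * (S.+1 * L.+1))%N.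
Proof.
rewrite size_cat !size_allpairs !size_iota.
by rewrite mulnACA [(2 * 2)%N]/= mulnC.
Qed.

(** Used to absorb the logarithmic number of exponents into a small power of [T]. *)
Lemma ln_le_powR {R : realType} {delta : R} (T : R) : 0 < delta -> 0 < T ->
  ln T <= T `^ delta / delta.
Proof.
move=> d0 T0; rewrite ler_pdivlMr// mulrC /powR gt_eqF//.
by apply: le_trans (expR_ge1Dx _); rewrite lerDr.
Qed.

Definition good_event (R : realType) : set 'M[int]_2 :=
  [set g | hyperbolic g /\ `|eps_eigenvalue R g| = fundamental_unit (trace_field R g)].

(** The hypotheses on [S] and [L] are what the smaller unit [e] requires. From
    [e^2 <= e^n <= |tr g| <= 2T] follows [e < 2 sqrt T], and [s <= e + 1]; from [e^2 > 2] follows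
    [2^n <= e^(2n) <= 4T^2]. *)
Lemma bad_SL2Z_ball_subset {R : realType} {T : R} (S L : nat) :
  2 <= T -> 2 * Num.sqrt T + 1 <= S.+1%:R ->
  (forall n : nat, 2 ^+ n <= 4 * T ^+ 2 -> (n <= L)%N) ->
  SL2Z_ball T `&` ~` good_event R `<=`
  [set` unipotents (Num.truncn T) ++
    flatten [seq trace_fiber (Num.truncn T) t | t <- small_traces R S L]].
Proof.
move=> T2 ST LT g [gT gbad]; have [gSL _] := gT.
have gN i j := SL2Z_ball_entry R T g i j gT.
suff : (g \in unipotents (Num.truncn T)) || (g \in flatten
    [seq trace_fiber (Num.truncn T) t | t <- small_traces R S L]) by rewrite -mem_cat.
have /orP[gu|gfib] := mem_trace_fiber _ _ gSL gN; apply/orP; [by left|right].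
apply/flatten_mapP; exists (\tr g) => //.
suff : (\tr g \in [:: -2; -1; 0; 1; 2]) || (\tr g \in power_traces R S L).
  by rewrite -mem_cat.
have [hyp|nhyp] := boolP (2 < `|\tr g|); last first.
  apply/orP; left; rewrite !inE; lia.
have neq : `|eps_eigenvalue R g| != fundamental_unit (trace_field R g).
  by apply/eqP => eq; apply: gbad.
have [s [b [n [se e1 e2 n1 [et tE]]]]] := nonfundamental_trace gSL hyp neq.
set e := quad_root R s b in se e1 e2 et tE.
have e0 := lt_trans ltr01 e1.
have T0 : 0 <= T by lra.
have t2T : `|\tr g|%:~R <= 2 * T.
  have NT : (Num.truncn T)%:R <= T by rewrite -truncn_ge_nat.
  apply: (@le_trans _ _ (2 * Num.truncn T)%:Z%:~R); last by rewrite -pmulrn natrM ler_pM2l.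
  have -> : (2 * Num.truncn T)%:Z = (Num.truncn T)%:Z + (Num.truncn T)%:Z by lia.
  by rewrite ler_int mxtrace2 (le_trans (ler_normD _ _))// lerD.
have sS : (s <= S)%N.
  rewrite -ltnS -(ltr_nat R).
  have eT : e ^+ 2 <= 2 * T.
    by apply: le_trans (le_trans et t2T); rewrite ler_eXn2l.
  have := sqr_sqrtr T0; have := sqrtr_ge0 T; move: (Num.sqrt T) ST => Y ST Y0 Y2.
  have : e < 2 * Y by nra.
  lra.
have nL : (n <= L)%N.
  apply: LT; apply: (@le_trans _ _ ((e ^+ 2) ^+ n)).
    by rewrite lerXn2r ?nnegrE ?sqr_ge0// ltW.
  rewrite -exprM mulnC exprM.
  have : 0 <= e ^+ n by rewrite exprn_ge0// ltW.
  by have := le_trans et t2T; nra.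
apply/orP; right; apply/allpairsP.
exists ((s, b), (n, if 0 <= \tr g then 1 else -1)); split.
- by apply/allpairsP; exists (s, b); rewrite mem_iota add0n ltnS sS; case: b e se e1 e2 et tE e0.
- apply/allpairsP; exists (n, if 0 <= \tr g then 1 else -1); rewrite mem_iota add0n ltnS nL.
  by split=> //; case: ifP.
- by rewrite [RHS]/= -/e -tE; case: ifP => h; lia.
Qed.

(** The factor [T] counts the entries [a], and [sqrt T] the traces [s] of the smaller unit. One
    factor [T ^ delta] comes from the exponents, two from the divisor bound at arguments up to
    [T^2]. *)
Lemma card_bad_SL2Z_ball {R : realType} {delta : R} : 0 < delta ->
  exists2 K : R, 0 < K & forall T, 4 <= T ->
    #|` fset_set (SL2Z_ball T `&` ~` good_event R)|%:R <=
      K * (T * Num.sqrt T * (T `^ delta) ^+ 3).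
Proof.
move=> d0; have [C C0 divC] := divisor_bound R delta d0.
have ln2 : 0 < ln 2 :> R by rewrite ln_gt0 ?ltr1n.
(* The inequalities [2^n <= 4 T^2 <= T^3] give [n ln 2 <= 3 ln T <= 3 T^delta / delta]. *)
pose C1 : R := 3 / (delta * ln 2).
have C1_gt0 : 0 < C1 by rewrite divr_gt0// mulr_gt0.
(* The unipotents contribute at most [12 T]; [17 + 12 C1 = 5 + 12 (C1 + 1)] bounds the number of
   traces, and [6 C] the fibre over each. *)
exists (12 + (17 + 12 * C1) * (6 * C)); first by rewrite addr_gt0// !mulr_gt0// addr_gt0// mulr_gt0.
move=> T T4; have T0 : 0 < T by lra.
pose N := Num.truncn T; pose X := T `^ delta; pose Y := Num.sqrt T.
have Y2 : Y ^+ 2 = T by rewrite sqr_sqrtr// ltW.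
have Y_ge2 : 2 <= Y by rewrite -(ler_pXn2r (n := 2)) ?nnegrE ?sqrtr_ge0// Y2; lra.
have X1 : 1 <= X.
  by rewrite -(powRr0 T) ler_powR ?(ltW d0)//; lra.
pose S := Num.truncn (2 * Y + 1); pose L := Num.truncn (C1 * X); pose D := Num.truncn (C * X ^+ 2).
have NT : N%:R <= T by rewrite truncn_le ltW.
have SY : S%:R <= 2 * Y + 1 by rewrite truncn_le; lra.
have CX : 0 <= C1 * X by apply/ltW/mulr_gt0 => //; exact: powR_gt0.
have CX2 : 0 <= C * X ^+ 2 by apply/mulr_ge0/sqr_ge0/ltW.
have LX : L%:R <= C1 * X by rewrite truncn_le.
have DX : D%:R <= C * X ^+ 2 by rewrite truncn_le.
have SY' : 2 * Y + 1 <= S.+1%:R by rewrite ltW// truncnS_gt.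
have LT n : 2 ^+ n <= 4 * T ^+ 2 -> (n <= L)%N.
  move=> nT; rewrite truncn_ge_nat//.
  have n3 : n%:R * ln 2 <= 3 * ln T.
    have -> : n%:R * ln 2 = ln (2 ^+ n) :> R by rewrite lnXn// mulr_natl.
    have -> : 3 * ln T = ln (T ^+ 3) by rewrite lnXn// mulr_natl.
    rewrite ler_ln ?posrE ?exprn_gt0//; apply: (le_trans nT).
    by rewrite [leRHS]exprS ler_pM2r ?exprn_gt0.
  have := ln_le_powR T d0 T0; rewrite -/X ler_pdivlMr// => lnX.
  rewrite /C1 mulrAC ler_pdivlMr ?mulr_gt0//; nra.
have dD m : (m <= N ^ 2)%N -> (size (divisors m) <= D)%N.
  case: m => [_|m mN]; rewrite truncn_ge_nat//.
    (* The list [divisors 0] coincides with [divisors 1], so the bound at 1 covers 0. *)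
    have := divC 1%N isT; rewrite powR1 mulr1 => C1'.
    by apply: (le_trans C1'); rewrite ler_peMr ?(ltW C0)// exprn_ege1.
  apply: (le_trans (divC _ (ltn0Sn m))); rewrite ler_pM2l//.
  have -> : X ^+ 2 = (T ^+ 2) `^ delta.
    by rewrite -powR_mulrn ?powR_ge0// -[T ^+ 2]powR_mulrn ?ltW// /X powRAC.
  rewrite ge0_ler_powR ?nnegrE ?sqr_ge0 ?(ltW d0)//.
  apply: (@le_trans _ _ (N ^ 2)%:R); first by rewrite ler_nat.
  by rewrite natrX lerXn2r ?nnegrE// ltW.
have T2 : 2 <= T by lra.
have := card_fset_set_le_size _ _ _ (bad_SL2Z_ball_subset S L T2 SY' LT).
move=> /leq_trans; move/(_ (4 * (2 * N).+1 + (5 + 4 * (S.+1 * L.+1)) * ((2 * N).+1 * (2 * D)))%N).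
have /[swap]/[apply] : (size (unipotents N ++
    flatten [seq trace_fiber N t | t <- small_traces R S L]) <=
    4 * (2 * N).+1 + (5 + 4 * (S.+1 * L.+1)) * ((2 * N).+1 * (2 * D)))%N.
  rewrite size_cat size_unipotents leq_add2l size_flatten -(size_small_traces R) /shape -map_comp.
  by apply: sumn_map_leq => t _; exact: size_trace_fiber.
rewrite -(ler_nat R) => /le_trans; apply.
rewrite -[(2 * N).+1]addn1 -[S.+1]addn1 -[L.+1]addn1 !(natrD, natrM) -/X -/Y.
move: NT SY LX DX (ler0n R N) (ler0n R S) (ler0n R L) (ler0n R D).
move: N%:R S%:R L%:R D%:R => n s l dd nT sY lX dX n0 s0 l0 dd0.
have hn : 2 * n + 1 <= 3 * T by lra.
have hs : (s + 1) * (l + 1) <= 3 * Y * ((C1 + 1) * X).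
  by apply: ler_pM; rewrite ?addr_ge0//; lra.
have YX1 : 1 <= Y * X by nra.
have hsl : 5 + 4 * ((s + 1) * (l + 1)) <= (17 + 12 * C1) * (Y * X).
  by apply: (@le_trans _ _ (5 * (Y * X) + 4 * (3 * Y * ((C1 + 1) * X)))); lra.
have hd : (2 * n + 1) * (2 * dd) <= 3 * T * (2 * (C * X ^+ 2)).
  by apply: ler_pM; rewrite ?mulr_ge0 ?addr_ge0 ?mulr_ge0//; lra.
have hp := ler_pM _ _ hsl hd.
have {}hp : (5 + 4 * ((s + 1) * (l + 1))) * ((2 * n + 1) * (2 * dd)) <=
    (17 + 12 * C1) * (Y * X) * (3 * T * (2 * (C * X ^+ 2))).
  by apply: hp; rewrite ?(mulr_ge0, addr_ge0).
have TX : T <= T * Y * X ^+ 3.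
  rewrite -mulrA ler_peMr ?(ltW T0)// exprSr mulrCA mulr_ege1 ?exprn_ege1//.
apply: (@le_trans _ _ (12 * (T * Y * X ^+ 3) +
  (17 + 12 * C1) * (Y * X) * (3 * T * (2 * (C * X ^+ 2))))); first by lra.
by rewrite le_eqVlt; apply/orP; left; apply/eqP; ring.
Qed.

(** * From counting to probabilities *)

Lemma prob_sub1 {R : realType} {T : R} (E : set 'M[int]_2) :
  (0 < #|` fset_set (SL2Z_ball T)|)%N ->
  `|prob T E - 1| = #|` fset_set (SL2Z_ball T `&` ~` E)|%:R / #|` fset_set (SL2Z_ball T)|%:R.
Proof.
move=> n0; have fB := @finite_SL2Z_ball R T.
have fI (A : set 'M[int]_2) : finite_set (SL2Z_ball T `&` A).
  by apply: (sub_finite_set _ fB) => g [].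
have := cardfsUI (fset_set (SL2Z_ball T `&` E)) (fset_set (SL2Z_ball T `&` ~` E)).
rewrite -fset_setU// -fset_setI// -setIUr setUv setIT setIACA setICr setI0 fset_set0 cardfs0 addn0.
move=> cE; rewrite /prob cE natrD.
set a := #|` _|%:R; set b := #|` _|%:R.
have ab0 : 0 < a + b by rewrite -natrD -cE ltr0n.
have -> : a / (a + b) - 1 = - (b / (a + b)) by field; rewrite gt_eqF.
by rewrite normrN ger0_norm// divr_ge0// ltW.
Qed.

(** For [N] the integer part of [T/2], the assumption [T >= 4] gives [N >= T/4], whence the constant
    [64 = 4 * 4^2]. *)
Lemma card_SL2Z_ball_sqr {R : realType} {T : R} : 4 <= T ->
  T ^+ 2 <= 64 * #|` fset_set (SL2Z_ball T)|%:R.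
Proof.
move=> T4; pose N := Num.truncn (T / 2).
have NT : N%:R <= T / 2 by rewrite truncn_le; lra.
have NT' : T / 2 < N.+1%:R by rewrite truncnS_gt.
have : ((2 * N)%:R : R) <= T by rewrite natrM; lra.
move=> /card_SL2Z_ball_ge; rewrite -(ler_nat R) natrX natrM => h.
have N4 : T / 4 <= N%:R by move: NT'; rewrite -[N.+1]addn1 natrD; lra.
have : (T / 4) ^+ 2 <= N%:R ^+ 2 by rewrite lerXn2r ?nnegrE//; lra.
by move/le_trans => /(_ _ h); rewrite expr_div_n; lra.
Qed.

Lemma prob_good_event {R : realType} {eta : R} : 0 < eta ->
  exists2 C : R, 0 < C & \forall T \near +oo,
    `|prob T (good_event R) - 1| <= C * T `^ (- 2^-1 + eta).
Proof.
(* A third of [eta], since the count of bad matrices contains [(T ^ delta)^3]. *)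
move=> eta0; have d0 : 0 < eta / 3 by rewrite divr_gt0.
have [K K0 bad] := card_bad_SL2Z_ball d0.
exists (64 * K); first by rewrite mulr_gt0.
near=> T; have T4 : 4 <= T by near: T; apply: nbhs_pinfty_ge; rewrite num_real.
have T0 : 0 < T by lra.
have ball_ge := card_SL2Z_ball_sqr T4.
have ball0 : (0 < #|` fset_set (SL2Z_ball T)|)%N.
  by rewrite -(ltr0n R); have := exprn_gt0 2 T0; lra.
rewrite prob_sub1// ler_pdivrMr ?ltr0n//; apply: (le_trans (bad T T4)).
have -> : T `^ (- 2^-1 + eta) = (Num.sqrt T)^-1 * (T `^ (eta / 3)) ^+ 3.
  rewrite powRD ?(gt_eqF T0) ?implybT// powRN powR12_sqrt ?(ltW T0)//; congr (_ * _).
  by rewrite -powR_mulrn ?powR_ge0// -powRrM divfK.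
have Y2 := sqr_sqrtr (ltW T0); have Y0 : 0 < Num.sqrt T by rewrite sqrtr_gt0.
set X := _ ^+ 3; have X0 : 0 < X by rewrite exprn_gt0// powR_gt0.
have -> : T * Num.sqrt T * X = T ^+ 2 * ((Num.sqrt T)^-1 * X).
  move: Y2 Y0; move: (Num.sqrt T) => Y Y2 Y0.
  by rewrite -Y2; field; rewrite gt_eqF.
set Z := _^-1 * X; have Z0 : 0 < Z by rewrite mulr_gt0 ?invr_gt0.
have := ler_wpM2l (ltW (mulr_gt0 K0 Z0)) ball_ge.
by set B := #|` _|%:R; lra.
Unshelve. all: by end_near.
Qed.

Theorem theorem1 (R : realType) :
  (forall eta : R, 0 < eta ->
    exists2 C : R, 0 < C &
      \forall T \near +oo,
        `|prob T [set g | hyperbolic g /\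
            `|eps_eigenvalue R g| = fundamental_unit (trace_field R g)] - 1|
        <= C * T `^ (- 2^-1 + eta))
  /\
  prob T [set g | hyperbolic g /\
     exists u : R,
       unit_of (ring_of_integers (trace_field R g)) u /\
       has_field_norm (trace_field R g) u (-1)] @[T --> +oo] --> (0 : R).
Proof.
split=> [eta eta0|]; first exact: prob_good_event.
(* Any exponent [eta] below [1/2] would do; [1/4] leaves the decay [T^(-1/4)]. *)
have q0 : (0 : R) < 4^-1 by rewrite invr_gt0.
have [C C0 probC] := prob_good_event q0.
apply/cvgr0Pnorm_le => e e0; near=> T.
have T4 : 4 <= T by near: T; apply: nbhs_pinfty_ge; rewrite num_real.
have T0 : 0 < T by lra.
have ball0 : (0 < #|` fset_set (SL2Z_ball T)|)%N.
  by rewrite -(ltr0n R); have := exprn_gt0 2 T0; have := card_SL2Z_ball_sqr T4; lra.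
(* A hyperbolic matrix whose field has a unit of norm -1 lies outside [good_event]. *)
apply: (@le_trans _ _ `|prob T (good_event R) - 1|).
  rewrite prob_sub1// ger0_norm ?divr_ge0// ler_pM2r ?invr_gt0 ?ltr0n// ler_nat.
  apply: fsubset_leq_card; rewrite -fset_set_sub; last 2 first.
  - by apply: (sub_finite_set _ (finite_SL2Z_ball T)) => g [].
  - by apply: (sub_finite_set _ (finite_SL2Z_ball T)) => g [].
  move=> g [gT [ghyp [u [Uu uN]]]]; split=> // -[_ /eqP]; apply/negP.
  by apply: norm_neg1_not_fundamental uN => //; case: gT.
apply: (@le_trans _ _ (C * T `^ (- 2^-1 + 4^-1))).
  by near: T.
have -> : - 2^-1 + 4^-1 = - 4^-1 :> R by lra.
(* The inequality [C T^(-1/4) <= e] amounts to [T >= (C/e)^4], which holds for large [T]. *)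
rewrite powRN -ler_pdivlMl// invf_ple ?posrE ?powR_gt0 ?mulr_gt0 ?invr_gt0//.
rewrite invfM invrK.
have -> : C / e = ((C / e) `^ 4) `^ 4^-1.
  by rewrite -powRrM mulfV// powRr1// ltW// divr_gt0.
by rewrite ge0_ler_powR ?nnegrE ?powR_ge0 ?(ltW T0) ?(ltW q0).
Unshelve. all: by end_near.
Qed.
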